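(* Let $A\in\mathbb{R}^{n\times n}$ and $b\in\mathbb{R}^n$, and write $A_s=\frac12(A+A^T)$, $A_a=\frac12(A-A^T)$. Assume that both $A$ and $A_s$ are nonsingular. Then the matrix $A^TA_s^{-1}A$ is symmetric, the identities $$A^TA_s^{-1}A=A_s-A_aA_s^{-1}A_a,\qquad A^TA_s^{-1}b=b-A_aA_s^{-1}b$$ hold, and a vector $x\in\mathbb{R}^n$ is a solution of $Ax=b$ if and only if it is a solution of the linear symmetric equation $$A^TA_s^{-1}Ax=A^TA_s^{-1}b .$$
   Context: $A_s$ and $A_a$ are the symmetric and anti-symmetric parts of $A$, so $A=A_s+A_a$. *)

(* Defs.v *)
From mathcomp Require Import all_boot all_order all_algebra.
From mathcomp Require Import reals.

Set Implicit Arguments.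
Unset Strict Implicit.
Unset Printing Implicit Defensive.

Import GRing.Theory.
Local Open Scope ring_scope.

Definition sym_part (R : realType) (n : nat) (A : 'M[R]_n) : 'M[R]_n :=
  2^-1 *: (A + A^T).

Definition asym_part (R : realType) (n : nat) (A : 'M[R]_n) : 'M[R]_n :=
  2^-1 *: (A - A^T).

(* Main.v *)
Require Import Defs.
From mathcomp Require Import all_boot all_order all_algebra.
From mathcomp Require Import reals.

Import GRing.Theory Num.Theory.

Local Open Scope ring_scope.

(** Since $A^T=A_s-A_a$, right multiplication by $A_s^{-1}$ gives $A^TA_s^{-1}=I-A_aA_s^{-1}$.
    Applying this to $b$ and to $A=A_s+A_a$ yields both identities. Symmetry follows from that of
    $A_s^{-1}$, and the equivalence from cancelling the invertible factor $A^TA_s^{-1}$. *)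

Lemma sym_part_tr (R : realType) (n : nat) (A : 'M[R]_n) :
  (sym_part A)^T = sym_part A.
Proof. by rewrite /sym_part linearZ linearD /= trmxK addrC. Qed.

Lemma sym_partD_asym_part (R : realType) (n : nat) (A : 'M[R]_n) :
  sym_part A + asym_part A = A.
Proof.
rewrite /sym_part /asym_part -scalerDr addrACA subrr addr0 -mulr2n -scaler_nat.
by rewrite scalerA mulVf ?scale1r // pnatr_eq0.
Qed.

Lemma sym_partB_asym_part (R : realType) (n : nat) (A : 'M[R]_n) :
  sym_part A - asym_part A = A^T.
Proof.
rewrite /sym_part /asym_part -scalerBr opprB addrC addrA subrK.
by rewrite -mulr2n -scaler_nat scalerA mulVf ?scale1r // pnatr_eq0.
Qed.

Theorem mainTheorem2 (R : realType) (n : nat) (A : 'M[R]_n) (b : 'cV[R]_n)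
    (hA : A \in unitmx) (hAs : sym_part A \in unitmx) :
  let As := sym_part A in
  let Aa := asym_part A in
  [/\ A^T *m invmx As *m A \is symmetricmx,
      A^T *m invmx As *m A = As - Aa *m invmx As *m Aa,
      A^T *m invmx As *m b = b - Aa *m invmx As *m b
    & forall x : 'cV[R]_n,
        A *m x = b <-> A^T *m invmx As *m A *m x = A^T *m invmx As *m b].
Proof.
move=> As Aa.
have trE : A^T *m invmx As = 1%:M - Aa *m invmx As.
  by rewrite -sym_partB_asym_part mulmxBl mulmxV.
split.
(* [symmetricmx] is the Hermitian predicate with sign $(-1)^0$ and identity conjugation; removing
   both leaves $M=M^T$. *)
- apply/is_hermitianmxP; rewrite expr0 scale1r map_mx_id //.
  by rewrite !trmx_mul trmxK trmx_inv sym_part_tr mulmxA.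
(* Both explicit copies of $A$ in $A-A_aA_s^{-1}A$ are split; the two $A_a$ terms then cancel. *)
- rewrite trE mulmxBl mul1mx -{1 2}(sym_partD_asym_part _ _ A) -/As -/Aa.
  by rewrite mulmxDr mulmxKV // opprD addrA addrK.
- by rewrite trE mulmxBl mul1mx.
(* Nonsingularity of $A$ enters here, through $A^T$. *)
have hM : A^T *m invmx As \in unitmx.
  by rewrite unitmx_mul unitmx_tr unitmx_inv hA.
move=> x; rewrite -mulmxA; split=> [-> //|].
exact: (can_inj (mulKmx hM)).
Qed.
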